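(* Let $\pi\colon(X,T)\to(Y,S)$ be a factor map, let $d\ge 1$, and let $y\in Y$ be such that the diagonal point $(y,\dots,y)\in Y^d$ is recurrent under $S\times S^2\times\dots\times S^d$. If $x\in\pi^{-1}(y)$ is such that the pair $(x,z)$ is distal for every $z\in\pi^{-1}(y)$ with $z\ne x$, then the diagonal point $(x,\dots,x)\in X^d$ is recurrent under $T\times T^2\times\dots\times T^d$. In particular, if $y$ is multi-recurrent (and $x\in\pi^{-1}(y)$ is such that $(x,z)$ is distal for every $z\in\pi^{-1}(y)$ with $z\neq x$), then $x$ is multi-recurrent.
   Context: A (topological) dynamical system $(X,T)$ consists of a (nonempty) compact metric space $(X,\rho)$ and a continuous map $T\colon X\to X$. A factor map $\pi\colon(X,T)\to(Y,S)$ is a continuous surjection $\pi\colon X\to Y$ with $\pi\circ T=S\circ\pi$. A point $z$ of a system $(Z,R)$ with metric $\rho$ is recurrent under $R$ if $\liminf_{n\to\infty}\rho(R^nz,z)=0$. A pair $(x,z)\in X^2$ is distal if $\liminf_{n\to\infty}\rho(T^nx,T^nz)>0$. A point $x\in X$ is multi-recurrent if for every $d\ge 1$ there exists a strictly increasing sequence $\{n_k\}_{k=1}^\infty$ of positive integers such that $T^{in_k}x\to x$ as $k\to\infty$ for each $i=1,\dots,d$; equivalently, for every $d\geq 1$ the point $(x,\dots,x)\in X^d$ is recurrent under $T\times T^2\times\dots\times T^d$. *)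

(* Defs.v *)
From HB Require Import structures.
From mathcomp Require Import all_boot all_order all_algebra.
From mathcomp Require Import all_classical all_reals all_analysis.

Set Implicit Arguments.
Unset Strict Implicit.
Unset Printing Implicit Defensive.

Import Order.TTheory GRing.Theory Num.Theory.

Local Open Scope classical_set_scope.
Local Open Scope ring_scope.

Section FfunMetric.
Context {R : realType} {I : finType} {X : metricType R}.
Implicit Types u v w : {ffun I -> X}.

Definition ffun_dist u v : R := \big[Num.max/0]_i mdist (u i) (v i).

Lemma ffun_dist_leP u v (e : R) : 0 <= e ->
  reflect (forall i, mdist (u i) (v i) <= e) (ffun_dist u v <= e).
Proof.
move=> e0; apply: (iffP (bigmax_leP _ _ _ _)) => [[_ h] i|h]; first exact: h.
by split=> // i _; exact: h.
Qed.

Lemma ffun_dist_ge0 u v : 0 <= ffun_dist u v.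
Proof. exact: bigmax_ge_id. Qed.

Lemma mdist_le_ffun_dist u v i : mdist (u i) (v i) <= ffun_dist u v.
Proof. by move: i; apply/ffun_dist_leP => //; exact: ffun_dist_ge0. Qed.

Lemma ffun_distxx u : ffun_dist u u = 0.
Proof.
apply/eqP; rewrite eq_le ffun_dist_ge0 andbT.
by apply/ffun_dist_leP => // i; rewrite mdistxx.
Qed.

Lemma ffun_dist_positivity u v : ffun_dist u v = 0 -> u = v.
Proof.
move=> uv0; apply/ffunP => i; apply: mdist_positivity; apply/eqP.
by rewrite eq_le mdist_ge0 andbT -uv0 mdist_le_ffun_dist.
Qed.

Lemma ffun_dist_sym u v : ffun_dist u v = ffun_dist v u.
Proof. by apply: eq_bigr => i _; rewrite metric_sym. Qed.

Lemma ffun_dist_triangle v u w :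
  ffun_dist u w <= ffun_dist u v + ffun_dist v w.
Proof.
apply/ffun_dist_leP => [|i]; first by rewrite addr_ge0 // ffun_dist_ge0.
by rewrite (le_trans (metric_triangle _ (v i) _))// lerD// mdist_le_ffun_dist.
Qed.

(* The library puts no topology on {ffun I -> X}: this instance makes it the
   finite power X^I with the maximum metric, which induces the product
   topology. *)
HB.instance Definition _ := isMetric.Build R {ffun I -> X}
  ffun_distxx ffun_dist_positivity ffun_dist_sym ffun_dist_triangle.

Lemma mdist_ffunE u v : mdist u v = \big[Num.max/0]_i mdist (u i) (v i).
Proof. by []. Qed.

End FfunMetric.

Section DynamicalSystems.
Context {R : realType}.

Definition dynamical_system (X : metricType R) (T : X -> X) : Prop :=
  [/\ [set: X] !=set0, compact [set: X] & continuous T].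

Definition factor_map (X Y : metricType R) (T : X -> X) (S : Y -> Y)
    (p : X -> Y) : Prop :=
  [/\ continuous p, set_surj [set: X] [set: Y] p & p \o T = S \o p].

Definition recurrent (Z : metricType R) (f : Z -> Z) (z : Z) : Prop :=
  limn_einf (fun n => (mdist (iter n f z) z)%:E) = 0%E.

Definition distal (X : metricType R) (T : X -> X) (x z : X) : Prop :=
  (0 < limn_einf (fun n => (mdist (iter n T x) (iter n T z))%:E))%E.

(* T \times T^2 \times ... \times T^d; ordinals start at 0, hence the i.+1 *)
Definition prod_iter (X : metricType R) (d : nat) (T : X -> X)
    (u : {ffun 'I_d -> X}) : {ffun 'I_d -> X} :=
  [ffun i : 'I_d => iter i.+1 T (u i)].

Definition diag_pt (X : metricType R) (d : nat) (x : X) : {ffun 'I_d -> X} :=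
  [ffun=> x].

Definition multi_recurrent (X : metricType R) (T : X -> X) (x : X) : Prop :=
  forall d : nat, (1 <= d)%N ->
  exists m : nat -> nat,
    [/\ forall k, (0 < m k)%N,
        forall k l, (k < l)%N -> (m k < m l)%N
      & forall i, (1 <= i <= d)%N ->
          iter (i * m k)%N T x @[k --> \oo] --> x].

End DynamicalSystems.

(* Main.v *)
Require Import Defs.
From mathcomp Require Import all_boot all_order all_algebra.
From mathcomp Require Import all_classical all_reals all_analysis.
Import Order.TTheory GRing.Theory Num.Theory.
Import numFieldNormedType.Exports.

Local Open Scope classical_set_scope.

(** A point x over a diagonally recurrent point y stays recurrent because
    recurrence always lifts to some point of the fibre, at the price of moving
    x to a point proximal to it, and distality forbids moving x at all.

    The lifting statement, [recurrent_proximal_lift], concerns a single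
    compact system (Z, F) over (W, G): if q z is recurrent, there is a limit
    point w of the orbit of z, in the fibre of z, such that the orbits of z
    and of w come close to w simultaneously. Consider the limit points f of
    the iterates of F for pointwise convergence on Z -> Z (the Ellis
    semigroup) that keep f z in the fibre of z. They form a closed
    semigroup under composition: a limit of iterates maps fibres into fibres
    [iter_limits_fiber], and there is such an f because q z is recurrent
    [iter_limits_returning]. By Ellis and Numakura
    [idempotent_in_compact_semigroup] it contains an idempotent e, and
    w := e z works: both z and w are sent to w by e, and e is a limit of
    iterates.

    This is applied to T x T^2 x ... x T^d on the compact power X^d, at the
    diagonal point of x. The resulting w lies coordinatewise in the fibre of
    y, and its i-th coordinate is T^i-proximal, hence T-proximal, to x
    [proximal_prod_iter_not_distal]; so w is the diagonal point of x, which is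
    therefore a limit point of its own orbit. The statement on
    multi-recurrence follows, since multi-recurrence amounts to diagonal
    recurrence for all d. *)

Set Implicit Arguments.
Unset Strict Implicit.
Unset Printing Implicit Defensive.

(** * Limit points of sequences *)

Lemma cluster_app (S T : topologicalType) (phi : S -> T) (F : set_system S) a :
  {for a, continuous phi} -> cluster F a -> cluster (phi @ F) (phi a).
Proof.
move=> cphi Fa A B PA Ba; have [s [As Bs]] := Fa (phi @^-1` A) _ PA (cphi _ Ba).
by exists (phi s).
Qed.

Lemma cluster_seqP (T : topologicalType) (u : nat -> T) a :
  cluster (u @ \oo) a <->
  forall U N, nbhs a U -> exists2 n, (N <= n)%N & U (u n).
Proof.
split=> [ua U N Ua|ua V U [N _ NV] Ua].
  have [|_ [[n /= Nn <-] Un]] := ua (u @` [set n | N <= n]%N) U _ Ua.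
    by exists N => // n Nn /=; exists n.
  by exists n.
by have [n Nn Un] := ua U N Ua; exists (u n); split=> //; exact: NV.
Qed.

(** * Idempotents in compact right-topological semigroups *)

Lemma chain_compact_bigcap (E : topologicalType) (D : set (set E)) :
  D !=set0 -> total_on D subset ->
  (forall B, D B -> [/\ closed B, compact B & B !=set0]) ->
  \bigcap_(B in D) B !=set0.
Proof.
move=> [B0 DB0] totD Dgood.
have PF : ProperFilter (filter_from D id).
  apply: filter_from_proper => [|B /Dgood[]//].
  apply: filter_from_filter; first by exists B0.
  move=> B C DB DC; have [BC|CB] := totD _ _ DB DC.
    by exists B => // b Bb; split=> //; exact: BC.
  by exists C => // b Bb; split=> //; exact: CB.
have [_ cB0 _] := Dgood _ DB0.
have [|p [_ clp]] := cB0 _ PF; first by exists B0.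
exists p => B DB; have [clB _ _] := Dgood _ DB.
by apply: clB => V Vp; apply: clp => //; exists B.
Qed.

Section EllisNumakura.
Variables (E : topologicalType) (op : E -> E -> E).
Hypotheses (hausE : hausdorff_space E) (opA : associative op).
(* Translations on one side only: composition of arbitrary self-maps is not
   continuous in its other argument. *)
Hypothesis op_cont : forall b, continuous (op^~ b).

Definition closed_subsemigroup (B : set E) :=
  [/\ closed B, B !=set0 & forall a b, B a -> B b -> B (op a b)].

(** Zorn's lemma is used in its union form, so it is applied to the sets that
    are removed from A; by compactness chains keep a nonempty intersection. *)
Lemma minimal_closed_subsemigroup (A : set E) :
  compact A -> closed_subsemigroup A ->
  exists B, [/\ closed_subsemigroup B, B `<=` A &
    forall C, closed_subsemigroup C -> C `<=` B -> C = B].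
Proof.
move=> cA gA.
pose P C := closed_subsemigroup (A `\` C).
have [|C [PC maxC]] := @Zorn_bigcup _ P.
  move=> F FP totF.
  (* A is thrown in so that the empty chain needs no separate treatment. *)
  pose D := A |` [set A `\` C | C in F].
  have Dgood B : D B -> closed_subsemigroup B /\ B `<=` A.
    by case=> [->|[C /FP FC <-]] //; split=> // a [].
  have totD : total_on D subset.
    move=> B1 B2 [->|[C1 F1 <-]] [->|[C2 F2 <-]].
    - by left.
    - by right => a [].
    - by left => a [].
    - have [C12|C21] := totF _ _ F1 F2.
        by right => a [Aa na]; split=> // /C12.
      by left => a [Aa na]; split=> // /C21.
  have eqD : A `\` \bigcup_(X in F) X = \bigcap_(B in D) B.
    apply/seteqP; split=> [a [Aa na] B [->//|[C FC <-]]|a Da].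
      by split=> // Ca; apply: na; exists C.
    split; first by apply: Da; left.
    by move=> [C FC Ca]; have [] : (A `\` C) a by apply: Da; right; exists C.
  rewrite /P eqD; split.
  - by apply: closed_bigI => B /Dgood[[]].
  - apply: chain_compact_bigcap => //; first by exists A; left.
    move=> B /Dgood[[clB B0 _] BA]; split=> //.
    exact: subclosed_compact cA BA.
  - move=> a b Da Db B DB; have [[_ _ opB] _] := Dgood _ DB.
    by apply: opB; [exact: Da|exact: Db].
exists (A `\` C); split=> // B gB BAC.
apply/seteqP; split=> // a [Aa nCa]; apply: contrapT => nBa.
apply: (maxC (~` B)).
  split=> [b Cb /BAC[]//|/(_ a nBa)//].
rewrite /P setDE setCK.
suff -> : A `&` B = B by [].
by apply/seteqP; split=> b => [[]|Bb] //; split=> //; have [] := BAC _ Bb.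
Qed.

(** Ellis-Numakura: any element a of a minimal closed subsemigroup B is
    idempotent. Indeed B a is again a closed subsemigroup, so B a = B and a is
    of the form b a; hence the stabiliser of a in B is a nonempty closed
    subsemigroup, so it is B and contains a. *)
Lemma idempotent_in_compact_semigroup (A : set E) :
  compact A -> closed_subsemigroup A -> exists2 e, A e & op e e = e.
Proof.
move=> cA gA.
have [B [[clB [a Ba] opB] BA minB]] := minimal_closed_subsemigroup cA gA.
have cB : compact B by exact: subclosed_compact cA BA.
have BaE : (op^~ a) @` B = B.
  apply: minB; last by move=> _ [b Bb <-]; exact: opB.
  split.
  - apply: compact_closed => //; apply: continuous_compact => //.
    exact/continuous_subspaceT/op_cont.
  - by exists (op a a); exists a.
  - move=> _ _ [b Bb <-] [c Bc <-]; exists (op (op b a) c);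
      last by rewrite !opA.
    by apply: (opB _ _ _ Bc); exact: opB.
have stabE : B `&` (op^~ a) @^-1` [set a] = B.
  apply: minB => [|b []//]; split.
  - apply: closedI => //; apply: (closed_comp (fun x _ => @op_cont a x)).
    exact/accessible_closed_set1/hausdorff_accessible.
  - by have : B a by []; rewrite -{1}BaE => -[b Bb ba]; exists b.
  - move=> b c [Bb /= ba] [Bc /= ca]; split; first exact: opB.
    by rewrite /= -opA ca.
have : B a by [].
by rewrite -{1}stabE => -[_ aa]; exists a => //; exact: BA.
Qed.

End EllisNumakura.

(** * Lifting recurrence through the Ellis semigroup *)

Section AuslanderEllis.
Variables (Z : uniformType) (W : topologicalType).
Variables (F : Z -> Z) (G : W -> W) (q : Z -> W).
Hypotheses (hausZ : hausdorff_space Z) (cZ : compact [set: Z]).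
Hypothesis hausW : hausdorff_space W.
Hypotheses (cF : continuous F) (cq : continuous q) (qFG : q \o F = G \o q).

Lemma semiconj_iter n u : q (iter n F u) = iter n G (q u).
Proof.
by elim: n => //= n <-; move: (congr1 (fun h => h (iter n F u)) qFG).
Qed.

Lemma continuous_iter n : continuous (iter n F).
Proof.
elim: n => [|n IH] u; first exact: cvg_id.
exact: continuous_comp (IH u) (@cF (iter n F u)).
Qed.

Let E : topologicalType := {ptws Z -> Z}.

Lemma continuous_eval u : continuous (fun f : E => f u).
Proof. exact: (@proj_continuous Z (fun=> Z) u). Qed.

Lemma continuous_semiconj_eval u : continuous (fun f : E => q (f u)).
Proof.
by move=> f; exact: (continuous_comp (@continuous_eval u f) (@cq (f u))).
Qed.

Lemma continuous_ptws (T : topologicalType) (h : T -> E) :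
  (forall u, continuous (fun t => h t u)) -> continuous h.
Proof.
move=> ch t.
have FF : Filter (h @ t) by exact: fmap_filter.
by apply/(@pointwise_cvgP Z Z _ (h t) FF) => u; exact: ch.
Qed.

Lemma continuous_precomp (g : E) : continuous (fun f : E => f \o g : E).
Proof.
by apply: continuous_ptws => u; exact: continuous_eval.
Qed.

Lemma continuous_postcomp (h : Z -> Z) :
  continuous h -> continuous (fun f : E => h \o f : E).
Proof.
move=> ch; apply: continuous_ptws => u f.
exact: (continuous_comp (@continuous_eval u f) (@ch (f u))).
Qed.

Lemma hausdorff_ptws : hausdorff_space E.
Proof. exact: hausdorff_product. Qed.

Lemma compact_ptws : compact [set: E].
Proof.
have := @tychonoff Z (fun=> Z) (fun=> setT) (fun=> cZ).
by congr compact; apply/seteqP; split.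
Qed.

(** The elements of the Ellis semigroup that are limits along arbitrarily
    large times, so that their values are limit points of orbits. *)
Definition iter_limits : set E := cluster ((fun n => iter n F : E) @ \oo).

(** Although f need not be continuous, approximating f o g first in f and then
    in g only uses continuity of precomposition by g and of postcomposition by
    an iterate of F. *)
Lemma iter_limits_comp f g :
  iter_limits f -> iter_limits g -> iter_limits (f \o g).
Proof.
move=> /cluster_seqP Lf /cluster_seqP Lg; apply/cluster_seqP => U N Ufg.
have [n Nn Un] := Lf _ N (@continuous_precomp g f _ (nbhs_interior Ufg)).
have [m _ Um] := Lg _ 0%N (@continuous_postcomp _ (@continuous_iter n) g _ Un).
exists (n + m)%N; first by rewrite (leq_trans Nn) ?leq_addr.
suff -> : iter (n + m) F = iter n F \o iter m F by [].
by apply/funext => u; rewrite /= iterD.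
Qed.

(** Iterates of F map fibres of q into fibres of q, and this passes to
    pointwise limits as W is Hausdorff. *)
Lemma iter_limits_fiber f u v :
  iter_limits f -> q u = q v -> q (f u) = q (f v).
Proof.
move=> Lf quv; apply: hausW => A B Au Bv.
have [n _ [An Bn]] : exists2 n, (0 <= n)%N &
    ([set h : E | A (q (h u)) /\ B (q (h v))]) (iter n F).
  by apply: (cluster_seqP _ f).1 => //; apply: filterI; 
    [exact: (@continuous_semiconj_eval u f)
    |exact: (@continuous_semiconj_eval v f)].
exists (q (iter n F u)); split=> //.
by rewrite semiconj_iter quv -semiconj_iter.
Qed.

(** By compactness, the iterates of F accumulate along the return times of
    q z to its neighbourhoods. *)
Lemma iter_limits_returning z :
  cluster ((fun n => iter n G (q z)) @ \oo) (q z) ->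
  exists2 f, iter_limits f & q (f z) = q z.
Proof.
move=> rec.
pose H := filter_from [set NU : nat * set W | nbhs (q z) NU.2]
  (fun NU => [set n | (NU.1 <= n)%N /\ NU.2 (iter n G (q z))]).
have PH : ProperFilter H.
  apply: filter_from_proper => [|[N U] /= Uz].
    apply: filter_from_filter; first by exists (0%N, setT); exact: filterT.
    move=> [N U] [M V] /= Uz Vz; exists (maxn N M, U `&` V).
      exact: filterI.
    by move=> n /= []; rewrite geq_max => /andP[Nn Mn] [].
  by have [n Nn Un] := (cluster_seqP _ _).1 rec _ N Uz; exists n.
have [f [_ clf]] := @compact_ptws ((fun n => iter n F : E) @ H) _ filterT.
exists f.
  apply: cvg_cluster clf => A [N _ NA].
  by exists (N, setT) => [|n [/= Nn _]]; [exact: filterT|exact: NA].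
have HqF : q (iter n F z) @[n --> H] --> q z.
  by move=> U Uz; exists (0%N, U) => // n [/= _]; rewrite semiconj_iter.
apply/esym/hausW; apply: (cvg_cluster HqF).
exact: (@cluster_app E W (fun h => q (h z)) _ f
  (@continuous_semiconj_eval z f) clf).
Qed.

(** The third clause is proximality of z and w, in the strong form that the two
    orbits meet at w itself. *)
Lemma recurrent_proximal_lift z :
  cluster ((fun n => iter n G (q z)) @ \oo) (q z) ->
  exists w, [/\ q w = q z, cluster ((fun n => iter n F z) @ \oo) w &
    cluster ((fun n => (iter n F z, iter n F w)) @ \oo) (w, w)].
Proof.
move=> rec; have [f0 Lf0 qf0] := iter_limits_returning rec.
pose M : set E := [set f | iter_limits f /\ q (f z) = q z].
have clM : closed M.
  apply: closedI.
    rewrite /iter_limits clusterE.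
    by apply: closed_bigI => A _; exact: closed_closure.
  apply: (@closed_comp E W (fun h : E => q (h z)) [set q z]
    (fun f _ => @continuous_semiconj_eval z f)).
  exact/(@accessible_closed_set1 W)/hausdorff_accessible.
have [|||||e [Le qe] ee] :=
    @idempotent_in_compact_semigroup E (fun f g => f \o g) _ _ _ M.
- exact: hausdorff_ptws.
- by [].
- exact: continuous_precomp.
- exact: subclosed_compact clM compact_ptws _.
- split=> //; first by exists f0.
  move=> f g [Lf qf] [Lg qg]; split; first exact: iter_limits_comp.
  by rewrite /= (iter_limits_fiber Lf qg).
have ew : e (e z) = e z by rewrite -[in RHS]ee.
exists (e z); split=> //.
  exact: cluster_app (@continuous_eval z e) Le.
(* The two orbits are the images of the iterates under f |-> (f z, f (e z)),
   which sends e to (e z, e z). *)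
have := @cluster_app E _ (fun h => (h z, h (e z))) _ e _ Le.
rewrite ew; apply.
apply: cvg_pair; first exact: nbhs_filter.
  exact: (@continuous_eval z e).
exact: (@continuous_eval (e z) e).
Qed.

End AuslanderEllis.

Local Open Scope ring_scope.

(** * Recurrence and distality in terms of limit points *)

Section MetricSequences.
Context {R : realType}.

Lemma cluster_mdistP (X : metricType R) (u : nat -> X) a :
  cluster (u @ \oo) a <->
  forall (e : R) N, 0 < e -> exists2 n, (N <= n)%N & mdist (u n) a < e.
Proof.
split=> [/cluster_seqP ua e N e0|ua].
  have [n Nn] := ua _ N (nbhsx_ballx a e e0).
  by rewrite ballEmdist /= metric_sym; exists n.
apply/cluster_seqP => U N /nbhs_ballP[e /= e0 eU].
have [n Nn une] := ua e N e0; exists n => //; apply: eU.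
by rewrite ballEmdist /= metric_sym.
Qed.

Lemma limn_einf_supE (u : nat -> \bar R) :
  limn_einf u = ereal_sup (range (einfs u)).
Proof.
by rewrite limn_einf_lim; apply: cvg_lim => //; exact: cvg_einfs_sup.
Qed.

Lemma limn_einf_ge0 (u : nat -> R) : (forall n, 0 <= u n) ->
  (0 <= limn_einf (fun n => (u n)%:E))%E.
Proof.
move=> u0; rewrite limn_einf_supE.
apply: le_trans (ereal_sup_ubound (imageT _ 0%N)).
by apply: le_ereal_inf_tmp => _ [n _ <-]; rewrite lee_fin.
Qed.

Lemma limn_einf_eq0P (u : nat -> R) : (forall n, 0 <= u n) ->
  limn_einf (fun n => (u n)%:E) = 0%E <->
  forall (e : R) N, 0 < e -> exists2 n, (N <= n)%N & u n < e.
Proof.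
move=> u0; split=> [u_0 e N e0|small].
  have : (einfs (fun n => (u n)%:E) N < e%:E)%E.
    apply: (@le_lt_trans _ _ 0%E); last by rewrite lte_fin.
    rewrite -u_0 limn_einf_supE.
    exact: ereal_sup_ubound (imageT _ N).
  by move=> /ereal_inf_lt[_ [n /= Nn <-]]; rewrite lte_fin; exists n.
apply/eqP; rewrite eq_le limn_einf_ge0 // andbT.
rewrite limn_einf_supE.
apply: ge_ereal_sup => _ [N _ <-]; apply/lee_addgt0Pr => e e0; rewrite add0e.
have [n Nn une] := small e N e0.
by apply: ge_ereal_inf; exists (u n)%:E; [exists n|rewrite lee_fin ltW].
Qed.

Lemma recurrentP (Z : metricType R) (f : Z -> Z) z :
  recurrent f z <-> cluster ((fun n => iter n f z) @ \oo) z.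
Proof.
apply: (iff_trans (limn_einf_eq0P (fun n => mdist_ge0 _ _))).
exact: iff_sym (cluster_mdistP _ _).
Qed.

Lemma distal_separated (X : metricType R) (T : X -> X) x z : distal T x z ->
  exists e N, 0 < e /\
    forall n, (N <= n)%N -> e <= mdist (iter n T x) (iter n T z).
Proof.
move=> dxz; apply: contrapT => near_xz; move: dxz; rewrite /distal.
suff -> : limn_einf (fun n => (mdist (iter n T x) (iter n T z))%:E) = 0%E.
  by rewrite ltxx.
apply/limn_einf_eq0P => [n|e N e0]; first exact: mdist_ge0.
apply: contrapT => far; apply: near_xz; exists e, N; split=> // n Nn.
by rewrite leNgt; apply/negP => close_n; apply: far; exists n.
Qed.

(** The distances to a form a real sequence clustering at 0, for which a
    convergent subsequence is known to exist. *)
Lemma cluster_subsequence (X : metricType R) (u : nat -> X) a :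
  cluster (u @ \oo) a ->
  exists m : nat -> nat, [/\ forall k, (0 < m k)%N,
    forall k l, (k < l)%N -> (m k < m l)%N & u (m k) @[k --> \oo] --> a].
Proof.
move=> /cluster_mdistP ua.
have /cluster_eventually_cvg[f fincr fcvg] :
    cluster ((fun n => mdist (u n) a) @ \oo) 0.
  apply/cluster_eventuallyP => e N e0; have [n Nn une] := ua e N e0.
  by exists n => //; rewrite sub0r normrN ger0_norm ?mdist_ge0 // ltW.
have fmono k l : (k < l)%N -> (f k < f l)%N.
  by move=> kl; have := leW_mono fincr k l; rewrite !ltEnat /= => ->.
(* The shift makes the indices positive. *)
exists (f \o S); split=> [k|k l kl|] /=; last 1 first.
- apply/metricType_numDomainType.cvgrPdist_lt => e e0.
  move/cvgrPdist_lt: fcvg => /(_ e e0)[N _ Nf]; exists N => // k /= Nk.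
  have := Nf k.+1 (leqW Nk).
  by rewrite /= sub0r normrN ger0_norm ?mdist_ge0 // metric_sym.
- exact: leq_ltn_trans (leq0n (f k)) (fmono _ _ (ltnSn k)).
- exact: fmono.
Qed.

End MetricSequences.

(** * Finite powers of a metric space *)

Section FiniteProducts.
Context {R : realType} {I : finType} {X : metricType R}.
Implicit Types u v : {ffun I -> X}.

Lemma cvg_ffun (J : Type) (F : set_system J) (h : J -> {ffun I -> X}) u :
  Filter F -> (forall i, h t i @[t --> F] --> u i) -> h @ F --> u.
Proof.
move=> FF hu; apply/metricType_numDomainType.cvgrPdist_lt => e e0.
have : \forall t \near F, forall i, mdist (u i) (h t i) < e.
  by apply: filter_forall => i; exact: metricType_numDomainType.cvgr_dist_lt.
apply: filterS => t uh; rewrite mdist_ffunE.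
by apply/bigmax_ltP; split.
Qed.

Lemma continuous_ffun (T : topologicalType) (h : T -> {ffun I -> X}) :
  (forall i, continuous (fun t => h t i)) -> continuous h.
Proof.
move=> ch t; apply: (@cvg_ffun _ (nbhs t) h (h t) (nbhs_filter t)) => i.
exact: ch.
Qed.

Lemma continuous_ffun_coord i : continuous (fun u : {ffun I -> X} => u i).
Proof.
move=> u; have FF : Filter (nbhs u) by exact: nbhs_filter.
apply/(@metricType_numDomainType.cvgrPdist_lt R X _ _ FF) => e e0.
apply: filterS (nbhsx_ballx u e e0) => v; rewrite ballEmdist.
exact/le_lt_trans/mdist_le_ffun_dist.
Qed.

(** The finite power is a continuous image of the product space, to which
    Tychonoff's theorem applies. *)
Lemma compact_ffun : compact [set: X] -> compact [set: {ffun I -> X}].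
Proof.
move=> cX; pose h (f : {ptws I -> X}) : {ffun I -> X} := [ffun i => f i].
have ch : continuous h.
  apply: continuous_ffun => i.
  have -> : (fun f => h f i) = @proj I (fun=> X) i.
    by apply/funext => f; rewrite ffunE.
  exact: proj_continuous.
have := @tychonoff I (fun=> X) (fun=> setT) (fun=> cX).
move/(@continuous_compact {ptws I -> X} {ffun I -> X} h _
  (continuous_subspaceT ch)).
congr compact; apply/seteqP; split=> // u _.
by exists (u : I -> X) => //; apply/ffunP => i; rewrite ffunE.
Qed.

End FiniteProducts.

(** * The system of successive powers of a map *)

Section ProductSystem.
Context {R : realType} {X : metricType R}.
Variables (T : X -> X) (d : nat).

Lemma iter_prod_iter n (u : {ffun 'I_d -> X}) i :
  iter n (prod_iter T) u i = iter (i.+1 * n)%N T (u i).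
Proof.
elim: n => [|n IH]; first by rewrite muln0.
by rewrite iterS ffunE IH -iterD mulnS.
Qed.

Lemma continuous_prod_iter : continuous T -> continuous (prod_iter (d := d) T).
Proof.
move=> cT; apply: continuous_ffun => i.
have -> : (fun u => prod_iter T u i) =
    (fun u : {ffun 'I_d -> X} => iter i.+1 T (u i)).
  by apply/funext => u; rewrite ffunE.
move=> u.
exact: (continuous_comp (@continuous_ffun_coord _ _ _ i u)
  (@continuous_iter X T cT i.+1 (u i))).
Qed.

(** In the coordinate of index i the product orbits run along the multiples of
    i.+1, and proximality along a subsequence is already incompatible with
    distality. *)
Lemma proximal_prod_iter_not_distal (u w : {ffun 'I_d -> X}) i :
  cluster ((fun n => (iter n (prod_iter T) u, iter n (prod_iter T) w)) @ \oo)
    (w, w) ->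
  ~ distal T (u i) (w i).
Proof.
move=> prox /distal_separated[e [N [e0 far]]].
have e20 : 0 < e / 2 by rewrite divr_gt0.
have [n Nn [/= un wn]] : exists2 n, (N <= n)%N &
    (ball w (e / 2) `*` ball w (e / 2))
      (iter n (prod_iter T) u, iter n (prod_iter T) w).
  apply: ((cluster_seqP _ _).1 prox).
  by exists (ball w (e / 2), ball w (e / 2)) => //; split; exact: nbhsx_ballx.
have := far (i.+1 * n)%N (leq_trans Nn (leq_pmull n (ltn0Sn i))).
apply/negP; rewrite -ltNge -!iter_prod_iter.
apply: le_lt_trans (mdist_le_ffun_dist _ _ i) _.
apply: le_lt_trans (ffun_dist_triangle w _ _) _.
rewrite [ltRHS]splitr; move: un wn; rewrite !ballEmdist /= => un wn.
by apply: ltrD => //; rewrite ffun_dist_sym.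
Qed.

Lemma multi_recurrent_prod_iter x : (0 < d)%N ->
  multi_recurrent T x -> recurrent (prod_iter T) (diag_pt d x).
Proof.
move=> d0 /(_ d d0)[m [m_gt0 m_incr m_cvg]]; apply/recurrentP/cluster_seqP.
have m_ge k : (k <= m k)%N.
  by elim: k => // k /leq_ltn_trans; apply; exact: m_incr.
move=> U N Ux.
have : iter (m k) (prod_iter T) (diag_pt d x) @[k --> \oo] --> diag_pt d x.
  apply: cvg_ffun => i; under eq_fun do rewrite iter_prod_iter ffunE.
  by rewrite ffunE; apply: m_cvg; rewrite ltn_ord.
move=> /(_ U Ux)[K _ KU]; exists (m (maxn N K)).
  exact: leq_trans (leq_maxl N K) (m_ge _).
by apply: KU => /=; exact: leq_maxr.
Qed.

End ProductSystem.

Lemma prod_iter_multi_recurrent (R : realType) (X : metricType R)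
    (T : X -> X) x :
  (forall d, (0 < d)%N -> recurrent (prod_iter T) (diag_pt d x)) ->
  multi_recurrent T x.
Proof.
move=> recT d d0.
have /recurrentP/cluster_subsequence[m [m0 mincr mcvg]] := recT d d0.
exists m; split=> // i /andP[i0 id].
have lt_id : (i.-1 < d)%N by rewrite prednK.
pose j := Ordinal lt_id.
have -> : (fun k => iter (i * m k)%N T x) =
    (fun k => iter (m k) (prod_iter T) (diag_pt d x) j).
  by apply/funext => k; rewrite iter_prod_iter ffunE /= prednK.
rewrite -[X in _ --> X](ffunE (fun=> x) j).
exact: (cvg_comp _ _ mcvg (@continuous_ffun_coord _ _ _ j (diag_pt d x))).
Qed.

(** * Recurrence of distal lifts *)

Theorem theorem3p12 (R : realType) (X Y : metricType R)
    (T : X -> X) (S : Y -> Y) (p : X -> Y)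
    (hT : dynamical_system T) (hS : dynamical_system S)
    (hp : factor_map T S p)
    (y : Y) (x : X) (hx : (p @^-1` [set y]) x)
    (hdistal : forall z : X, (p @^-1` [set y]) z -> z <> x -> distal T x z) :
  (forall d : nat, (1 <= d)%N ->
     recurrent (prod_iter S) (diag_pt d y) ->
     recurrent (prod_iter T) (diag_pt d x))
  /\ (multi_recurrent S y -> multi_recurrent T x).
Proof.
have [_ cX cT] := hT; have [cp _ pTS] := hp.
have px : p x = y by [].
have lift d : recurrent (prod_iter S) (diag_pt d y) ->
    recurrent (prod_iter T) (diag_pt d x).
  move=> /recurrentP recy.
  pose q (u : {ffun 'I_d -> X}) : {ffun 'I_d -> Y} := [ffun i => p (u i)].
  have cq : continuous q.
    apply: continuous_ffun => i.
    have -> : (fun u => q u i) = (fun u : {ffun 'I_d -> X} => p (u i)).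
      by apply/funext => u; rewrite ffunE.
    by move=> u; exact: (continuous_comp
      (@continuous_ffun_coord _ _ _ i u) (@cp (u i))).
  have p_iter n v : p (iter n T v) = iter n S (p v) by exact: semiconj_iter.
  have qTS : q \o prod_iter T = prod_iter S \o q.
    by apply/funext => u; apply/ffunP => i; rewrite /= !ffunE p_iter.
  have qx : q (diag_pt d x) = diag_pt d y.
    by apply/ffunP => i; rewrite !ffunE px.
  rewrite -qx in recy.
  have [w [qw clw prox]] := recurrent_proximal_lift
    (@metric_hausdorff R {ffun 'I_d -> X}) (compact_ffun cX)
    (@metric_hausdorff R {ffun 'I_d -> Y}) (continuous_prod_iter cT) cq
    qTS recy.
  suff wx : w = diag_pt d x by apply/recurrentP; move: clw; rewrite wx.
  apply/ffunP => i; rewrite [RHS]ffunE; apply: contrapT => wx.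
  apply: (proximal_prod_iter_not_distal (i := i) prox); rewrite ffunE.
  apply: hdistal; last by [].
  by have := congr1 (fun v : {ffun 'I_d -> Y} => v i) qw; rewrite !ffunE px.
split=> [d _|recy]; first exact: lift.
apply: prod_iter_multi_recurrent => d d0.
by apply: lift; exact: multi_recurrent_prod_iter.
Qed.
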